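(* Let $(A_1A_2A_3A_4,g)$ be a $(q,l)$-pair. Then the six points $G_{is}$, $i,s\in\{1,2,3,4\}$, $i\neq s$ (the poles of the line $g$ with respect to the Sharygin's curves $k_{is}$), and the three diagonal points of the quadrangle $A_1A_2A_3A_4$ lie on one conic section.
   Context: The ambient plane is the extended Euclidean plane, i.e. the Euclidean plane complemented with its points at infinity and its line at infinity $\omega$ (a model of the real projective plane). $XY$ denotes the line joining points $X,Y$, and $a\cap b$ the intersection point of lines $a,b$. A complete quadrangle $A_1A_2A_3A_4$ is a set of four points, no three collinear, together with the six lines $A_pA_q$; its diagonal points are $A_1A_2\cap A_3A_4$, $A_1A_3\cap A_2A_4$, $A_1A_4\cap A_2A_3$. A $(q,l)$-pair $(A_1A_2A_3A_4,g)$ consists of a complete quadrangle and a line $g$ of its plane (possibly $g=\omega$) which is not incident with any vertex nor with any of the diagonal points. Put $U_{pq}=U_{qp}=g\cap A_pA_q$ ($p\neq q$). For $\{p,q,r,t\}=\{1,2,3,4\}$ the Sharygin's points are $M_{pq}^r=A_pU_{qt}\cap A_qA_r$; thus the four Sharygin's points associated with $A_p,A_q$ are $M_{pq}^r,M_{pq}^t,M_{qp}^r,M_{qp}^t$. The point $G_{pq}=G_{qp}$ is the intersection point of the line $A_pA_q$ with the line $M_{pq}^rM_{pq}^t$ (the line $M_{qp}^rM_{qp}^t$ passes through the same point). The Sharygin's curve $k_{pq}$ is the conic through $A_p,A_q$ and the four Sharygin's points associated with $A_p,A_q$; when it is nondegenerate, $G_{pq}$ is the pole of $g$ with respect to $k_{pq}$.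 *)

(* Defs.v *)
From mathcomp Require Import all_boot all_order all_algebra.
From mathcomp Require Import reals.
Set Implicit Arguments.
Unset Strict Implicit.
Unset Printing Implicit Defensive.
Import GRing.Theory.
Local Open Scope ring_scope.

(* The extended Euclidean plane in homogeneous coordinates: its points are the
   1-dimensional subspaces of R^3 and its lines the 2-dimensional ones, so that
   joining is the sum of subspaces, intersecting is their intersection, and
   incidence is inclusion.  The Euclidean point (x, y) is the span of
   (x, y, 1), and the line at infinity is the subspace of all (x, y, 0); it is
   a line like any other. *)
Notation flat R := {vspace 'rV[R]_3}.

Definition is_point (R : realType) (P : flat R) : Prop := \dim P = 1%N.

Definition is_line (R : realType) (l : flat R) : Prop := \dim l = 2%N.

Definition collinear (R : realType) (P Q S : flat R) : Prop :=
  exists l : flat R, is_line l /\ [/\ P <= l, Q <= l & S <= l]%VS.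

(* The vertices are indexed by 'I_4 = {0, 1, 2, 3}.  Below, a family indexed by
   p, q, r, t is only meaningful when these are the four indices in some order,
   that is, when uniq [:: p; q; r; t]. *)
Definition complete_quadrangle (R : realType) (A : 'I_4 -> flat R) : Prop :=
  (forall p, is_point (A p)) /\
  (forall p q r, uniq [:: p; q; r] -> ~ collinear (A p) (A q) (A r)).

Definition diagonal_point (R : realType) (A : 'I_4 -> flat R)
    (p q r t : 'I_4) : flat R :=
  ((A p + A q) :&: (A r + A t))%VS.

Definition ql_pair (R : realType) (A : 'I_4 -> flat R) (g : flat R) : Prop :=
  [/\ complete_quadrangle A,
      is_line g,
      forall p, ~~ (A p <= g)%VS
    & forall p q r t, uniq [:: p; q; r; t] ->
        ~~ (diagonal_point A p q r t <= g)%VS].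

Definition U_point (R : realType) (A : 'I_4 -> flat R) (g : flat R)
    (p q : 'I_4) : flat R :=
  (g :&: (A p + A q))%VS.

(* M_{pq}^r; the remaining index t is passed explicitly. *)
Definition sharygin_point (R : realType) (A : 'I_4 -> flat R) (g : flat R)
    (p q r t : 'I_4) : flat R :=
  ((A p + U_point A g q t) :&: (A q + A r))%VS.

(* G_{pq}; the remaining indices r and t play symmetric roles. *)
Definition G_point (R : realType) (A : 'I_4 -> flat R) (g : flat R)
    (p q r t : 'I_4) : flat R :=
  ((A p + A q) :&:
   (sharygin_point A g p q r t + sharygin_point A g p q t r))%VS.

(* A conic, possibly degenerate, is given by a nonzero symmetric matrix K, as
   the locus v K v^T = 0; it is nondegenerate when K is invertible. *)
Definition is_conic (R : realType) (K : 'M[R]_3) : Prop :=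
  K^T = K /\ K != 0.

Definition nondegenerate_conic (R : realType) (K : 'M[R]_3) : Prop :=
  K \in unitmx.

(* Requiring P to be a point matters: the equation alone would hold for the
   zero subspace. *)
Definition on_conic (R : realType) (K : 'M[R]_3) (P : flat R) : Prop :=
  is_point P /\ forall v, v \in P -> v *m K *m v^T = 0.

(* P is the pole of g, i.e. g consists of the points conjugate to P. *)
Definition is_pole (R : realType) (K : 'M[R]_3) (P g : flat R) : Prop :=
  is_point P /\
  forall v, v \in g <-> (forall u, u \in P -> u *m K *m v^T = 0).

Definition is_sharygin_curve (R : realType) (A : 'I_4 -> flat R) (g : flat R)
    (p q r t : 'I_4) (k : 'M[R]_3) : Prop :=
  [/\ is_conic k,
      on_conic k (A p) /\ on_conic k (A q),
      on_conic k (sharygin_point A g p q r t) /\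
      on_conic k (sharygin_point A g p q t r)
    & on_conic k (sharygin_point A g q p r t) /\
      on_conic k (sharygin_point A g q p t r)].

(* Main.v *)
Require Import Defs.
From mathcomp Require Import all_boot all_order all_algebra.
From mathcomp Require Import reals.
From mathcomp Require Import ring.
Set Implicit Arguments.
Unset Strict Implicit.
Unset Printing Implicit Defensive.
Import GRing.Theory.
Local Open Scope ring_scope.

(** The vertices can be given representatives a_0, .., a_3 whose sum is 0: four
    vectors of a 3-dimensional space are linearly dependent, and no coefficient
    of the relation vanishes because no three vertices are collinear, so the
    coefficients can be absorbed into the vectors ([frame_exists]).  The line g
    is the kernel of a linear form f ([hyperplane_kernel]).  In this symmetric
    frame the configuration depends only on the weights c_i = f (a_i), which
    add up to 0; that the vertices and the diagonal points avoid g says that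
    c_i <> 0 and c_i + c_j <> 0.  All points then have short representatives:
    - a diagonal point:  a_p + a_q;
    - U_pq:              c_q a_p - c_p a_q;
    - M_pq^r:            (c_q + c_t) a_q + c_q a_r;
    - G_pq:              c_p a_q + c_q a_p, up to sign the sum of the
      representatives of M_pq^r and M_pq^t.

    Poles.  Let k be a conic through A_p, A_q, M_pq^r and M_pq^t, with polar
    form B.  Since a_t = - (a_p + a_q + a_r), the difference of the equations
    for M_pq^t and M_pq^r is a multiple of
      c_p B(a_q, a_r) + c_q B(a_p, a_r) = c_r B(a_p, a_q),
    which together with B(a_p, a_p) = B(a_q, a_q) = 0 says that
    B(G_pq, v) = B(a_p, a_q) f(v) for every v ([polar_G_vector]).  When k is
    nondegenerate the factor is not 0, and the polar of G_pq is g.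

    The common conic.  The quadratic form
      Q(y) = 2 sum_i c_i y_i^2 - (sum_i c_i y_i) (sum_i y_i)
    on 4-dimensional space has (1, 1, 1, 1) in its radical, because the weights
    add up to 0, so it descends to the plane along y |-> sum_i y_i a_i.  Its
    polar form takes the value 2 c_i at (a_i, a_i) and - (c_i + c_j) at
    (a_i, a_j), from which Q vanishes at a_p + a_q and at c_p a_q + c_q a_p.
    The three diagonal points form a basis in which the matrix of Q has zero
    diagonal and off-diagonal entries - 2 (c_i + c_j); its determinant is
    a product of nonzero factors, hence the conic is nondegenerate. *)

(** * Subspaces of small dimension *)

Section LinearAlgebra.
Variables (F : fieldType) (V : vectType F).
Implicit Types (U W : {vspace V}) (u v w : V).

Lemma memv_add_vlineP u v w :
  reflect (exists x y, u = x *: v + y *: w) (u \in <[v]> + <[w]>)%VS.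
Proof.
apply: (iffP memv_addP) => [[_ /vlineP[x ->] [_ /vlineP[y ->] ->]]|[x [y ->]]].
  by exists x, y.
by exists (x *: v); [exact: memvZ (memv_line v) | exists (y *: w)];
  rewrite ?memvZ ?memv_line.
Qed.

Lemma dim_add_vline v w : (\dim (<[v]> + <[w]>) <= 2)%N.
Proof.
apply: leq_trans (dimv_add_leqif _ _).1 _.
by rewrite !dim_vline; apply: leq_add (leq_b1 _) (leq_b1 _).
Qed.

(** The incidence criterion behind every intersection point below: two lines
    that differ by the point u meet exactly in any point they share. *)
Lemma capv_vline U W u v : (\dim U <= 2)%N -> u \in U -> u \notin W ->
  v != 0 -> v \in U -> v \in W -> (U :&: W = <[v]>)%VS.
Proof.
move=> dimU uU uW v0 vU vW; apply/eqP; rewrite eq_sym eqEdim.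
rewrite -memvE memv_cap vU vW dim_vline v0 /=.
rewrite -ltnS; apply: leq_trans dimU.
rewrite (ltn_leqif (dimv_leqif_sup (capvSl U W))).
by apply/negP => /subvP/(_ u uU); rewrite memv_cap (negPf uW) andbF.
Qed.

Lemma dim1_vline U : \dim U = 1%N -> exists2 u, u != 0 & U = <[u]>%VS.
Proof.
move=> dimU; have u0 : vpick U != 0 by rewrite vpick0 -dimv_eq0 dimU.
exists (vpick U) => //; apply/esym/eqP.
by rewrite eqEdim -memvE memv_pick dimU dim_vline u0.
Qed.

(** Collinearity asks for a line through the points even when they coincide,
    hence a subspace of small dimension has to be enlarged to a line. *)
Lemma subv_of_dim U n : (\dim U <= n <= \dim {:V})%N ->
  exists2 W, (U <= W)%VS & \dim W = n.
Proof.
elim: n => [|n IH] /andP[Un nV].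
  by exists U => //; apply/eqP; rewrite -leqn0.
move: Un; rewrite leq_eqVlt => /orP[/eqP Un|Un]; first by exists U.
have [|W UW dimW] := IH; first by rewrite -ltnS Un ltnW.
have e0 : vpick (W^C)%VS != 0.
  by rewrite vpick0 -dimv_eq0 dimv_compl dimW subn_eq0 -ltnNge.
exists (W + <[vpick (W^C)%VS]>)%VS; first exact: subv_trans UW (addvSl _ _).
rewrite dimv_disjoint_sum ?dimW ?dim_vline ?e0 ?addn1 //.
apply/eqP; rewrite -subv0 -(capv_compl W) capvS //.
by rewrite -memvE memv_pick.
Qed.

(** The form reads off the coordinate along a complement of the hyperplane, which
    is spanned by one vector. *)
Lemma hyperplane_kernel U : (\dim U).+1 = \dim {:V} ->
  exists f : {scalar V}, forall v, (v \in U) = (f v == 0).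
Proof.
move=> dimU.
have [|e e0 Ue] := @dim1_vline (U^C)%VS.
  by rewrite dimv_compl -dimU subSnn.
have disj : (U^C :&: U = 0)%VS by rewrite capvC capv_compl.
have free_e : free [tuple e] by rewrite /= seq1_free.
exists (coord [tuple e] ord0 \o daddv_pi (U^C) U) => v /=.
have vE : v = daddv_pi (U^C) U v + daddv_pi U (U^C) v.
  by rewrite daddv_pi_add // addvC addv_complf memvf.
rewrite {1}vE rpredDr ?memv_pi //.
have: daddv_pi (U^C) U v \in <[e]>%VS by rewrite -Ue memv_pi.
case/vlineP => x ->.
rewrite linearZ /= (coord_free ord0 ord0 free_e) mulr1.
have [->|x0] := eqVneq x 0; first by rewrite scale0r mem0v.
apply/negP => xe; case/negP: e0; rewrite -memv0 -disj memv_cap.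
rewrite {1}Ue memv_line /=.
by move: (memvZ x^-1 xe); rewrite scalerA mulVf // scale1r.
Qed.

End LinearAlgebra.

(** * Polar forms of symmetric matrices *)

(** Only the two 3-cycles avoid the diagonal. *)
Lemma det3_diag0 (F : comNzRingType) (b : nat -> nat -> F) : (forall i, b i i = 0) ->
  \det (\matrix_(i < 3, j < 3) b i j) =
    b 0 1 * b 1 2 * b 2 0 + b 0 2 * b 1 0 * b 2 1.
Proof.
move=> b0; rewrite (expand_det_row _ ord0) !big_ord_recl big_ord0 /cofactor.
rewrite !(expand_det_row _ ord0) !big_ord_recl !big_ord0 /cofactor.
rewrite !det_mx11 !mxE /= /bump /= !b0.
ring.
Qed.

Section PolarForm.
Variables (F : fieldType) (n : nat).
Implicit Types (K : 'M[F]_n) (u v w : 'rV[F]_n).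

Definition polar K u v : F := (u *m K *m v^T) 0 0.

Lemma polarDl K u v w : polar K (u + v) w = polar K u w + polar K v w.
Proof. by rewrite /polar !mulmxDl mxE. Qed.

Lemma polarDr K u v w : polar K u (v + w) = polar K u v + polar K u w.
Proof. by rewrite /polar linearD mulmxDr mxE. Qed.

Lemma polarZl K x u v : polar K (x *: u) v = x * polar K u v.
Proof. by rewrite /polar -!scalemxAl mxE. Qed.

Lemma polarZr K x u v : polar K u (x *: v) = x * polar K u v.
Proof. by rewrite /polar linearZ -scalemxAr mxE. Qed.

Lemma polarNl K u v : polar K (- u) v = - polar K u v.
Proof. by rewrite -scaleN1r polarZl mulN1r. Qed.

Lemma polarNr K u v : polar K u (- v) = - polar K u v.
Proof. by rewrite -scaleN1r polarZr mulN1r. Qed.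

Lemma polar_sumr K u I (s : seq I) (a : I -> 'rV[F]_n) :
  polar K u (\sum_(i <- s) a i) = \sum_(i <- s) polar K u (a i).
Proof.
elim: s => [|i s IH]; last by rewrite !big_cons polarDr IH.
by rewrite !big_nil -(scale0r 0) polarZr mul0r.
Qed.

Definition polarE := (polarDl, polarDr, polarZl, polarZr, polarNl, polarNr).

Lemma polarC K u v : K^T = K -> polar K u v = polar K v u.
Proof.
move=> KT; rewrite /polar.
suff -> : u *m K *m v^T = (v *m K *m u^T)^T by rewrite mxE.
by rewrite !trmx_mul trmxK KT mulmxA.
Qed.

Lemma polar_eq0 K u v : polar K u v = 0 <-> u *m K *m v^T = 0.
Proof.
split=> [uv0|]; last by rewrite /polar => ->; rewrite mxE.
by rewrite [LHS]mx11_scalar -/(polar K u v) uv0 raddf0.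
Qed.

Lemma polar_nondegenerate K u :
  K \in unitmx -> (forall v, polar K u v = 0) -> u = 0.
Proof.
move=> Ku u0; rewrite -[u](mulmxK Ku) (_ : u *m K = 0) ?mul0mx //.
apply/rowP => j; have := u0 (delta_mx 0 j).
by rewrite /polar trmx_delta -colE !mxE.
Qed.

Lemma mulmx_gram m (P : 'M_(m, n)) K :
  P *m K *m P^T = \matrix_(i, j) polar K (row i P) (row j P).
Proof.
apply/matrixP => i j; rewrite [RHS]mxE /polar -!row_mul mxE 2![RHS]mxE.
by apply: eq_bigr => k _; rewrite !mxE.
Qed.

(** A symmetric form can be prescribed freely on a basis, by transporting its
    Gram matrix along the change of basis. *)
Lemma polar_basis_exists (P S : 'M[F]_n) : P \in unitmx -> S^T = S ->
  exists2 K, K^T = K & forall i j, polar K (row i P) (row j P) = S i j.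
Proof.
move=> Pu ST; exists (invmx P *m S *m (invmx P)^T).
  by rewrite !trmx_mul trmxK ST mulmxA.
move=> i j; have /matrixP/(_ i j) := mulmx_gram P (invmx P *m S *m (invmx P)^T).
by rewrite !mulmxA mulmxV // mul1mx -mulmxA -trmx_mul mulmxV // trmx1 mulmx1 mxE.
Qed.

End PolarForm.

(** * Frames: four vectors in general position with sum zero *)

(** Derives distinctness of some of four indices from that of all four, whatever
    the order: every such fact is a Boolean combination of the six equalities. *)
Ltac uniq4 :=
  match goal with H : is_true (uniq [:: ?p; ?q; ?r; ?t]) |- _ =>
    move: H; rewrite /= !inE ?[q == p]eq_sym ?[r == p]eq_sym ?[t == p]eq_sym
      ?[r == q]eq_sym ?[t == q]eq_sym ?[t == r]eq_sym;
    by case: (p == q); case: (p == r); case: (p == t); case: (q == r);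
       case: (q == t); case: (r == t)
  end.

Section Frame.
Variable F : fieldType.
Implicit Types a : 'I_4 -> 'rV[F]_3.

Definition general_position (A : 'I_4 -> {vspace 'rV[F]_3}) :=
  forall p q r, uniq [:: p; q; r] -> ~~ (A p <= A q + A r)%VS.

(** The projective frame defined by four points, normalized symmetrically in the
    four vectors rather than by singling out the last one as a sum. *)
Definition frame a :=
  general_position (fun i => <[a i]>%VS) /\ \sum_i a i = 0.

Lemma big_ord4 (V : nmodType) (h : 'I_4 -> V) p q r t :
  uniq [:: p; q; r; t] -> \sum_i h i = h p + h q + h r + h t.
Proof.
move=> u; have [|| _ e] := uniq_min_size u (s2 := enum 'I_4).
- by move=> i _; rewrite mem_enum.
- by rewrite size_enum_ord.
rewrite -big_enum (perm_big [:: p; q; r; t]) /=.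
  by rewrite !big_cons big_nil addr0 !addrA.
by apply: uniq_perm => //; exact: enum_uniq.
Qed.

Lemma frame_notin a p q r : frame a -> uniq [:: p; q; r] ->
  a p \notin (<[a q]> + <[a r]>)%VS.
Proof. by case=> gp _ /gp. Qed.

Lemma general_position_coord0 a p q r x y z :
  general_position (fun i => <[a i]>%VS) -> uniq [:: p; q; r] ->
  x *: a p + y *: a q + z *: a r = 0 -> x = 0.
Proof.
move=> gp /gp apqr xyz; apply/eqP; apply: contraNT apqr => x0.
apply/memv_add_vlineP; exists (- y / x), (- z / x).
have -> : a p = x^-1 *: (x *: a p + y *: a q + z *: a r)
                 + (- y / x) *: a q + (- z / x) *: a r.
  by apply/rowP => i; rewrite !mxE; field.
by rewrite xyz scaler0 add0r.
Qed.

Lemma general_position_indep a p q r x y z :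
  general_position (fun i => <[a i]>%VS) -> uniq [:: p; q; r] ->
  x *: a p + y *: a q + z *: a r = 0 -> [/\ x = 0, y = 0 & z = 0].
Proof.
move=> gp upqr xyz.
have [uq ur] : uniq [:: q; r; p] /\ uniq [:: r; p; q].
  by split; [rewrite -(rot_uniq 2) | rewrite -(rot_uniq 1)].
split; first exact: general_position_coord0 xyz.
- by apply: (general_position_coord0 (y := z) (z := x) gp uq); rewrite addrC addrA.
- by apply: (general_position_coord0 (y := x) (z := y) gp ur); rewrite -addrA addrC.
Qed.

Lemma frame_span a p q r v : frame a -> uniq [:: p; q; r] ->
  exists x y z, v = x *: a p + y *: a q + z *: a r.
Proof.
move=> [gp _] u.
have fr : free [:: a p; a q; a r].
  apply/(@freeP _ _ 3 [tuple a p; a q; a r]) => k.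
  rewrite !big_ord_recl big_ord0 addr0 /= addrA => k0.
  have [k1 k2 k3] := general_position_indep gp u k0.
  case=> [[|[|[]]]] // lt_i3; [rewrite -[RHS]k1 | rewrite -[RHS]k2 |
    rewrite -[RHS]k3]; congr (k _); exact: val_inj.
have: v \in <<[:: a p; a q; a r]>>%VS.
  suff /eqP-> : <<[:: a p; a q; a r]>>%VS == fullv by rewrite memvf.
  by rewrite eqEdim subvf dimvf (eqnP fr).
rewrite !span_cons span_nil addv0.
case/memv_addP => _ /vlineP[x ->] [_ /memv_add_vlineP[y [z ->]] ->].
by exists x, y, z; rewrite addrA.
Qed.

Lemma frame_last a p q r t : frame a -> uniq [:: p; q; r; t] ->
  a t = - (a p + a q + a r).
Proof.
move=> [_ s0] u; apply/eqP; rewrite -addr_eq0 addrC.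
by rewrite -(big_ord4 a u) s0.
Qed.

End Frame.

(** The coefficients of a linear relation between representatives of the points
    are all nonzero, since a vanishing one would leave a relation between three
    points in general position; rescaling by them gives the frame. *)
Lemma frame_exists (F : fieldType) (A : 'I_4 -> {vspace 'rV[F]_3}) :
  (forall i, \dim (A i) = 1%N) -> general_position A ->
  exists2 a, frame a & forall i, A i = <[a i]>%VS.
Proof.
move=> dimA gpA.
have [b bE] : exists b, forall i, A i = <[b i]>%VS.
  exists (fun i => vpick (A i)) => i; have [e e0 Ae] := dim1_vline (dimA i).
  apply/esym/eqP; rewrite eqEdim -memvE memv_pick dimA dim_vline.
  by rewrite vpick0 Ae -dimv_eq0 dim_vline e0.
have gpb : general_position (fun i => <[b i]>%VS).
  by move=> p q r u; rewrite -!bE; exact: gpA.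
pose M := \matrix_i b i.
have /rowV0Pn[y /sub_kermxP yM y0] : kermx M != 0.
  rewrite -mxrank_eq0 mxrank_ker subn_eq0 -ltnNge.
  exact: leq_ltn_trans (rank_leq_col M) _.
have yb : \sum_i y 0 i *: b i = 0.
  by rewrite -[RHS]yM mulmx_sum_row; apply: eq_bigr => i _; rewrite rowK.
have y_neq0 i : y (ord0 : 'I_1) i != 0.
  apply: contraNneq y0 => yi0.
  pose l := lift i; pose k1 : 'I_3 := lift ord0 ord0.
  have ui : i \notin [:: l ord0; l k1; l ord_max].
    by rewrite !inE !negb_or !neq_lift.
  have ul : uniq [:: l ord0; l k1; l ord_max].
    by rewrite (map_inj_uniq (@lift_inj _ i) [:: ord0; k1; ord_max]).
  have u : uniq [:: i; l ord0; l k1; l ord_max] by rewrite cons_uniq ui.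
  move: yb; rewrite (big_ord4 _ u) yi0 scale0r add0r => yb'.
  have [z0 z1 z2] := general_position_indep gpb ul yb'.
  apply/eqP/rowP => j; rewrite mxE; case: (unliftP i j) => [k|] -> //.
  by case: k => [[|[|[]]]] // lt_k; [rewrite -[RHS]z0 | rewrite -[RHS]z1 |
    rewrite -[RHS]z2]; congr (y _ (l _)); exact: val_inj.
have yE i : <[y ord0 i *: b i]>%VS = <[b i]>%VS.
  apply/eqP; rewrite eqEdim !dim_vline scaler_eq0 (negPf (y_neq0 i)) leqnn andbT.
  by rewrite -memvE memvZ ?memv_line.
exists (fun i => y ord0 i *: b i) => [|i]; last by rewrite yE bE.
by split=> // p q r u; rewrite !yE; exact: gpb.
Qed.

(** * The configuration in terms of the weights *)

Section Configuration.
Variables (R : realType) (A : 'I_4 -> flat R) (g : flat R).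
Variables (a : 'I_4 -> 'rV[R]_3) (f : {scalar 'rV[R]_3}).
Hypotheses (a_frame : frame a) (aE : forall i, A i = <[a i]>%VS).
Hypothesis gE : forall v, (v \in g) = (f v == 0).
Hypothesis weight_neq0 : forall i, f (a i) != 0.
Let c i : R := f (a i).

Lemma weight_last p q r t : uniq [:: p; q; r; t] -> c t = - (c p + c q + c r).
Proof. by move=> u; rewrite /c (frame_last a_frame u) linearN !linearD. Qed.

Lemma indep p q r x y z : uniq [:: p; q; r] ->
  x *: a p + y *: a q + z *: a r = 0 -> [/\ x = 0, y = 0 & z = 0].
Proof. by case: a_frame => gp _; exact: general_position_indep. Qed.

Lemma diagonal_pointE p q r t : uniq [:: p; q; r; t] ->
  diagonal_point A p q r t = <[a p + a q]>%VS.
Proof.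
move=> u; rewrite /diagonal_point !aE.
apply: (capv_vline (u := a p)).
- exact: dim_add_vline.
- by rewrite memvE addvSl.
- by apply: frame_notin => //; uniq4.
- apply/eqP => pq0.
  have [||/eqP] := @indep p q r 1 1 0; first by uniq4.
    by rewrite !scale1r scale0r addr0.
  by rewrite oner_eq0.
- by apply/memv_add_vlineP; exists 1, 1; rewrite !scale1r.
- apply/memv_add_vlineP; exists (-1), (-1); rewrite (frame_last a_frame u).
  by apply/rowP => i; rewrite !mxE; ring.
Qed.

Lemma U_pointE p q r : uniq [:: p; q; r] ->
  U_point A g p q = <[c q *: a p - c p *: a q]>%VS.
Proof.
move=> u; rewrite /U_point !aE capvC.
apply: (capv_vline (u := a p)).
- exact: dim_add_vline.
- by rewrite memvE addvSl.
- by rewrite gE.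
- apply/eqP => pq0.
  have [|/eqP] := @indep p q r (c q) (- c p) 0 u.
    by rewrite scaleNr scale0r addr0.
  by rewrite (negPf (weight_neq0 q)).
- by apply/memv_add_vlineP; exists (c q), (- c p); rewrite scaleNr.
- by rewrite gE linearB !linearZ /= mulrC subrr.
Qed.

(** The vector depends on the index t, but not on p, because a_p can be
    eliminated from the point of A_pU_qt that lies on A_qA_r. *)
Definition sharygin_vector q r t := (c t + c q) *: a q + c q *: a r.

Lemma sharygin_vector_notin p q r t : uniq [:: p; q; r; t] ->
  sharygin_vector q r t \notin (<[a p]> + <[a q]>)%VS.
Proof.
move=> u; apply/negP => /memv_add_vlineP[x [y e]].
have [||_ _ /eqP] := @indep p q r x (y - (c t + c q)) (- c q); first by uniq4.
  rewrite scalerBl addrA -e scaleNr /sharygin_vector.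
  by apply/rowP => i; rewrite !mxE; ring.
by rewrite oppr_eq0 (negPf (weight_neq0 q)).
Qed.

Lemma sharygin_pointE p q r t : uniq [:: p; q; r; t] ->
  sharygin_point A g p q r t = <[sharygin_vector q r t]>%VS.
Proof.
move=> u; rewrite /sharygin_point (@U_pointE q t r); last by uniq4.
rewrite !aE; apply: (capv_vline (u := a p)).
- exact: dim_add_vline.
- by rewrite memvE addvSl.
- by apply: frame_notin => //; uniq4.
- by apply: contraNneq (sharygin_vector_notin u) => ->; rewrite mem0v.
- apply/memv_add_vlineP; exists (- c q), 1.
  by rewrite (frame_last a_frame u) /sharygin_vector;
     apply/rowP => i; rewrite !mxE; ring.
- by apply/memv_add_vlineP; exists (c t + c q), (c q).
Qed.

(** The harmonic conjugate, with respect to A_p and A_q, of the point U_pq. *)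
Definition G_vector p q := c p *: a q + c q *: a p.

Lemma G_vector_neq0 p q r : uniq [:: p; q; r] -> G_vector p q != 0.
Proof.
move=> u; apply/eqP => e.
have [|/eqP] := @indep p q r (c q) (c p) 0 u.
  by rewrite scale0r addr0 addrC.
by rewrite (negPf (weight_neq0 q)).
Qed.

Lemma G_pointE p q r t : uniq [:: p; q; r; t] ->
  G_point A g p q r t = <[G_vector p q]>%VS.
Proof.
move=> u; have u' : uniq [:: p; q; t; r] by uniq4.
rewrite /G_point !sharygin_pointE // !aE capvC.
apply: (capv_vline (u := sharygin_vector q r t)).
- exact: dim_add_vline.
- by rewrite memvE addvSl.
- exact: sharygin_vector_notin.
- by apply: (@G_vector_neq0 p q r); uniq4.
(* Adding the representatives of the two Sharygin points turns
   a_r + a_t into - (a_p + a_q) and c_r + c_t into - (c_p + c_q). *)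
- apply/memv_add_vlineP; exists (-1), (-1).
  rewrite /sharygin_vector /G_vector (frame_last a_frame u) (weight_last u).
  by apply/rowP => i; rewrite !mxE; ring.
- by apply/memv_add_vlineP; exists (c q), (c p); rewrite addrC.
Qed.

(** * The poles of g *)

Lemma on_conic_vline (K : 'M[R]_3) u :
  on_conic K <[u]>%VS <-> u != 0 /\ polar K u u = 0.
Proof.
split=> [[/eqP]|[u0 uu]].
  rewrite dim_vline => d H; split; first by case: (u != 0) d.
  by apply/polar_eq0/H/memv_line.
split; first by rewrite /is_point dim_vline u0.
by move=> _ /vlineP[x ->]; apply/polar_eq0; rewrite !polarE uu !mulr0.
Qed.

(** Up to the factor B(a_p, a_q), the polar of G_pq is the form f defining g.  On
    a_p and a_q this holds because k passes through these two vertices; on a_r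
    it is the relation T0, obtained by subtracting the two Sharygin conditions,
    in which the unknown value B(a_r, a_r) cancels. *)
Lemma polar_G_vector p q r t (k : 'M[R]_3) v : uniq [:: p; q; r; t] ->
  is_sharygin_curve A g p q r t k ->
  polar k (G_vector p q) v = polar k (a p) (a q) * f v.
Proof.
move=> u [[kT _] [kp kq] [k1 k2] _].
move: kp kq k1 k2; rewrite !sharygin_pointE ?aE; try by uniq4.
move=> /on_conic_vline[_ kp] /on_conic_vline[_ kq].
move=> /on_conic_vline[_ k1] /on_conic_vline[_ k2].
have T0 : c p * polar k (a q) (a r) + c q * polar k (a p) (a r)
          - c r * polar k (a p) (a q) = 0.
  have q0 : 2 * c q != 0 by rewrite mulf_neq0 ?weight_neq0 // Num.Theory.pnatr_eq0.
  suff e : 2 * c q * (c p * polar k (a q) (a r) + c q * polar k (a p) (a r)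
      - c r * polar k (a p) (a q)) =
    polar k (sharygin_vector q t r) (sharygin_vector q t r)
    - polar k (sharygin_vector q r t) (sharygin_vector q r t).
    by apply: (mulfI q0); rewrite e k1 k2 subrr mulr0.
  rewrite /sharygin_vector (frame_last a_frame u) (weight_last u) !polarE.
  rewrite (polarC (a q) (a p) kT) (polarC (a r) (a p) kT).
  by rewrite (polarC (a r) (a q) kT) kp kq; ring.
have [|x [y [z ->]]] := @frame_span _ a p q r v a_frame; first by uniq4.
rewrite !linearD !linearZ /= -!/(c _) /G_vector !polarE.
rewrite (polarC (a q) (a p) kT) kp kq; apply: subr0_eq.
by rewrite -[RHS](mulr0 z) -[in RHS]T0; ring.
Qed.

Lemma G_point_is_pole p q r t (k : 'M[R]_3) : uniq [:: p; q; r; t] ->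
  is_sharygin_curve A g p q r t k -> nondegenerate_conic k ->
  is_pole k (G_point A g p q r t) g.
Proof.
move=> u kS kN; have G0 : G_vector p q != 0 by apply: (@G_vector_neq0 p q r); uniq4.
rewrite G_pointE //; split; first by rewrite /is_point dim_vline G0.
(* A vanishing factor would put G_pq in the radical of k. *)
have lambda0 : polar k (a p) (a q) != 0.
  apply: contraNneq G0 => l0; apply/eqP/(polar_nondegenerate kN) => v.
  by rewrite (polar_G_vector v u kS) l0 mul0r.
move=> v; rewrite gE; split=> [/eqP fv _ /vlineP[x ->]|Gv].
  by apply/polar_eq0; rewrite polarE (polar_G_vector v u kS) fv !mulr0.
have /polar_eq0/eqP := Gv _ (memv_line _).
by rewrite (polar_G_vector v u kS) mulf_eq0 (negPf lambda0).
Qed.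

(** * The conic through the nine points *)

Hypothesis weight_add_neq0 :
  forall p q r t, uniq [:: p; q; r; t] -> c p + c q != 0.

Lemma sum_weights : \sum_i c i = 0.
Proof. by rewrite /c -linear_sum; case: a_frame => _ ->; rewrite linear0. Qed.

(** The polar form of Q(y) = 2 sum_i c_i y_i^2 - (sum_i c_i y_i) (sum_i y_i) on
    the standard basis of the 4-dimensional space; the sign makes the diagonal
    entries 2 c_i. *)
Definition gram i j : R := (if i == j then 1 else - 1) * (c i + c j).

Lemma gramC i j : gram i j = gram j i.
Proof. by rewrite /gram eq_sym [c i + _]addrC. Qed.

(** The vector (1, 1, 1, 1) lies in the radical of the form. *)
Lemma sum_gram i : \sum_j gram i j = 0.
Proof.
rewrite (bigD1 i) //= {1}/gram eqxx mul1r.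
under eq_bigr => j ji do rewrite /gram eq_sym (negPf ji) mulN1r.
have := sum_weights; rewrite sumrN big_split /= sumr_const cardC1 card_ord.
rewrite (bigD1 i) //= => /eqP; rewrite addrC addr_eq0 => /eqP->.
by rewrite -mulr_natr; ring.
Qed.

(** Prescribing the values on the basis a_0, a_1, a_2 is enough: both the vectors
    a_i and the rows of [gram] have sum zero, so the values at a_3 follow. *)
Lemma gram_form_exists : exists2 K : 'M[R]_3, K^T = K &
  forall i j, polar K (a i) (a j) = gram i j.
Proof.
pose w (i : 'I_3) := widen_ord (leqnSn 3) i.
pose P : 'M[R]_3 := \matrix_i a (w i).
pose S : 'M[R]_3 := \matrix_(i, j) gram (w i) (w j).
have Pu : P \in unitmx.
  rewrite -row_free_unit; apply: inj_row_free => v.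
  rewrite mulmx_sum_row !big_ord_recl big_ord0 addr0 addrA !rowK => /indep.
  move=> [//|v0 v1 v2]; apply/rowP => i; rewrite mxE.
  by case: i => [[|[|[]]]] // lt_i3; [rewrite -[RHS]v0 | rewrite -[RHS]v1 |
    rewrite -[RHS]v2]; congr (v _ _); exact: val_inj.
have [|K KT KE] := @polar_basis_exists _ _ P S Pu.
  by apply/matrixP => i j; rewrite !mxE gramC.
have Kw i j : polar K (a (w i)) (a (w j)) = gram (w i) (w j).
  by have := KE i j; rewrite !rowK mxE.
have last_extends u (h : 'I_4 -> R) : \sum_j h j = 0 ->
    (forall i, polar K u (a (w i)) = h (w i)) -> forall j, polar K u (a j) = h j.
  move=> h0 hw.
  have hl : polar K u (a ord_max) = h ord_max.
    case: a_frame => _; rewrite big_ord_recr /= => /eqP.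
    rewrite addrC addr_eq0 => /eqP ->; rewrite polarNr polar_sumr.
    move: h0; rewrite big_ord_recr /= => /eqP; rewrite addrC addr_eq0 => /eqP ->.
    by congr (- _); apply: eq_bigr => i _; exact: hw.
  move=> j; have [lt_j3|] := ltnP j 3; last first.
    move=> le3j; suff -> : j = ord_max by [].
    by apply: val_inj; apply/eqP; rewrite eqn_leq -ltnS ltn_ord.
  by rewrite (_ : j = w (Ordinal lt_j3)) ?hw //; exact: val_inj.
exists K => // i; apply: (last_extends) => [|j]; first exact: sum_gram.
rewrite polarC // gramC; move: i.
apply: (last_extends) => [|l]; first exact: sum_gram.
exact: Kw.
Qed.

Lemma gram_form_diag (K : 'M[R]_3) p :
  (forall i j, polar K (a i) (a j) = gram i j) ->
  polar K (a p) (a p) = 2 * c p.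
Proof. by move->; rewrite /gram eqxx; ring. Qed.

Lemma gram_form_offdiag (K : 'M[R]_3) p q :
  (forall i j, polar K (a i) (a j) = gram i j) -> p != q ->
  polar K (a p) (a q) = - (c p + c q).
Proof. by move=> -> /negPf pq; rewrite /gram pq; ring. Qed.

(** The form is computed in the basis of the diagonal points a_0 + a_1,
    a_0 + a_2, a_0 + a_3, where it vanishes on the diagonal. *)
Lemma gram_form_nondegenerate (K : 'M[R]_3) :
  (forall i j, polar K (a i) (a j) = gram i j) -> nondegenerate_conic K.
Proof.
move=> KE.
have Kd p := gram_form_diag p KE.
have Ko p q := @gram_form_offdiag K p q KE.
pose o m : 'I_4 := inord m.
have oK m n : (m < 4)%N -> (n < 4)%N -> (o m == o n) = (m == n).
  by move=> m4 n4; rewrite -val_eqE /= !inordK.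
pose P : 'M[R]_3 := \matrix_(i < 3) (a (o 0) + a (o i.+1)).
pose b m n := if m == n then 0 else - 2 * (c (o m.+1) + c (o n.+1)).
have gramP : P *m K *m P^T = \matrix_(i < 3, j < 3) b i j.
  rewrite mulmx_gram; apply/matrixP => i j; rewrite !mxE !rowK !polarE /b Kd.
  have i4 : (i.+1 < 4)%N := ltn_ord i.
  have j4 : (j.+1 < 4)%N := ltn_ord j.
  have [<-|ij] := eqVneq (i : nat) j.
    by rewrite Kd !Ko ?oK //; ring.
  by rewrite !Ko ?oK //; ring.
have det_neq0 : \det (P *m K *m P^T) != 0.
  rewrite gramP det3_diag0 => [|m]; last by rewrite /b eqxx.
  have -> : b 0 1 * b 1 2 * b 2 0 + b 0 2 * b 1 0 * b 2 1 =
    (- 16) * ((c (o 1) + c (o 2)) * (c (o 2) + c (o 3)) * (c (o 1) + c (o 3))).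
    by rewrite /b /=; ring.
  rewrite !mulf_neq0 ?oppr_eq0 ?Num.Theory.pnatr_eq0 //.
  - by apply: (@weight_add_neq0 _ _ (o 0) (o 3)); rewrite /= !inE !oK.
  - by apply: (@weight_add_neq0 _ _ (o 0) (o 1)); rewrite /= !inE !oK.
  - by apply: (@weight_add_neq0 _ _ (o 0) (o 2)); rewrite /= !inE !oK.
apply: contraNT det_neq0; rewrite /nondegenerate_conic unitmxE unitfE negbK.
by rewrite !det_mulmx => /eqP ->; rewrite mulr0 mul0r.
Qed.

Lemma common_conic_exists : exists K : 'M[R]_3,
  [/\ is_conic K, nondegenerate_conic K,
      forall p q r t : 'I_4, uniq [:: p; q; r; t] ->
        on_conic K (G_point A g p q r t)
    & forall p q r t : 'I_4, uniq [:: p; q; r; t] ->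
        on_conic K (diagonal_point A p q r t)].
Proof.
have [K KT KE] := gram_form_exists; exists K.
have Kd p := gram_form_diag p KE.
have Ko p q := @gram_form_offdiag K p q KE.
have neq (p q r t : 'I_4) : uniq [:: p; q; r; t] -> p != q /\ q != p.
  by rewrite [q == p]eq_sym /= !inE; case: (p == q).
have KN := gram_form_nondegenerate KE.
split.
- split=> //; apply/eqP => K0; move: KN.
  rewrite K0 /nondegenerate_conic unitmxE det0.
  by rewrite unitr0.
- exact: KN.
- move=> p q r t u; rewrite G_pointE //; apply/on_conic_vline; split.
    by apply: (@G_vector_neq0 p q r); uniq4.
  have [pq qp] := neq _ _ _ _ u.
  by rewrite /G_vector !polarE !Kd !Ko //; ring.
- move=> p q r t u; rewrite diagonal_pointE //; apply/on_conic_vline; split.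
    apply/eqP => pq0; have := weight_add_neq0 u.
    by rewrite /c -linearD pq0 linear0 eqxx.
  have [pq qp] := neq _ _ _ _ u.
  by rewrite !polarE !Kd !Ko //; ring.
Qed.

End Configuration.

(** * Geometric hypotheses and conclusion *)

Lemma quadrangle_general_position (R : realType) (A : 'I_4 -> flat R) :
  complete_quadrangle A -> general_position A.
Proof.
move=> [points ncol] p q r u; apply/negP => pqr; apply: (ncol p q r u).
have [|l sub dim_l] := @subv_of_dim _ _ (A q + A r)%VS 2.
  rewrite (leq_trans (dimv_add_leqif _ _)) ?points //.
  by rewrite dimvf.
exists l; split=> //; split; first exact: subv_trans pqr sub.
- exact: subv_trans (addvSl _ _) sub.
- exact: subv_trans (addvSr _ _) sub.
Qed.

Theorem theorem7 (R : realType) (A : 'I_4 -> {vspace 'rV[R]_3})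
    (g : {vspace 'rV[R]_3}) (hAg : ql_pair A g) :
  (forall (p q r t : 'I_4) (k : 'M[R]_3), uniq [:: p; q; r; t] ->
     is_sharygin_curve A g p q r t k -> nondegenerate_conic k ->
     is_pole k (G_point A g p q r t) g) /\
  (exists K : 'M[R]_3,
     [/\ is_conic K,
         nondegenerate_conic K,
         forall p q r t : 'I_4, uniq [:: p; q; r; t] ->
           on_conic K (G_point A g p q r t)
       & forall p q r t : 'I_4, uniq [:: p; q; r; t] ->
           on_conic K (diagonal_point A p q r t)]).
Proof.
have [quad dim_g A_g diag_g] := hAg.
have [a fr aE] := frame_exists (proj1 quad) (quadrangle_general_position quad).
have [|f gE] := @hyperplane_kernel _ _ g; first by rewrite dim_g dimvf.
have fa i : f (a i) != 0 by rewrite -gE memvE -aE.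
have fa_add p q r t : uniq [:: p; q; r; t] -> f (a p) + f (a q) != 0.
  by move=> /[dup] u /diag_g; rewrite (diagonal_pointE fr aE u) -memvE gE linearD.
split; last exact: common_conic_exists fr aE gE fa fa_add.
by move=> p q r t k; apply: (G_point_is_pole fr aE gE fa).
Qed.
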